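(* (i) For all integers $p_1\geq p_2\geq 2$, $R^{PM}(p_1,p_2)=p_1+\left\lceil\frac{p_2}{3}\right\rceil-1$. (ii) For all integers $p_1\geq p_2\geq p_3\geq 2$ such that $(p_1, p_2, p_3)\neq (3,3,3)$, $R^{PM}(p_1, p_2, p_3)= p_1+\left\lceil\frac{p_2}{3}\right\rceil+\left\lceil\frac{p_3}{3}\right\rceil-2$. Furthermore, $R^{PM}(3,3,3)=4$. (iii) For all integers $p_1\geq p_2\geq p_3\geq p_4\geq 2$ such that $(p_1, p_2, p_3, p_4)\not\in\{(3,3,3,3), (4,3,3,3)\}$, $R^{PM}(p_1, p_2, p_3, p_4)= p_1+\left\lceil\frac{p_2}{3}\right\rceil+\left\lceil\frac{p_3}{3}\right\rceil+\left\lceil\frac{p_4}{3}\right\rceil-3$. Furthermore, $R^{PM}(3,3,3,3)=4$ and $R^{PM}(4,3,3,3)=5$.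
   Context: A path-matching is a vertex-disjoint union of paths, each with at least 2 vertices; its order is the number of vertices it spans. An $r$-coloring of $K_n$ is an assignment of a color from $[r]=\{1,\dots,r\}$ to each edge of the complete graph $K_n$ (not necessarily proper, and not every color need be used). A path-matching of color $i$ is a path-matching that is a subgraph of $K_n$ all of whose edges have color $i$. For positive integers $r,p_1,\dots,p_r$, $R^{PM}(p_1,\dots,p_r)$ is the smallest integer $n$ such that in every $r$-coloring of the edges of $K_n$ there exists a path-matching of color $i$ and order at least $p_i$ for some $i\in[r]$.
   Formalization: In (iii) the tuple (3,3,3,2) is added to the exceptions, with R^PM(3,3,3,2)=4 asserted instead of the formula's value 3, since a rainbow coloring of K_3 with colors 1,2,3 shows the formula fails there. *)

(* Defs.v *)
From mathcomp Require Import all_boot all_order all_algebra zify.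

Set Implicit Arguments.
Unset Strict Implicit.
Unset Printing Implicit Defensive.

(* Only the values of a coloring on the 2-element sets, i.e. on the edges of
   the complete graph on 'I_n, are ever used. *)
Definition coloring (n r : nat) := {set 'I_n} -> 'I_r.

Definition color_class n r (c : coloring n r) (i : 'I_r) : rel 'I_n :=
  [rel x y | (x != y) && (c [set x; y] == i)].

(* Each path is given by the sequence of its vertices; uniqueness of the
   concatenation says both that no path repeats a vertex and that distinct
   paths are disjoint. *)
Definition path_matching (T : eqType) (e : rel T) (M : seq (seq T)) : bool :=
  [&& all (fun P => 1 < size P) M, all (sorted e) M & uniq (flatten M)].

Definition pm_order (T : Type) (M : seq (seq T)) : nat := size (flatten M).

Definition PM_arrows (n r : nat) (p : r.-tuple nat) : Prop :=
  forall c : coloring n r, exists (i : 'I_r) (M : seq (seq 'I_n)),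
    path_matching (color_class c i) M /\ tnth p i <= pm_order M.

(* [is_RPM p n] says that R^PM(p) is defined and equal to n. *)
Definition is_RPM (r : nat) (p : r.-tuple nat) (n : nat) : Prop :=
  PM_arrows n p /\ forall m, PM_arrows m p -> n <= m.

Definition ceil_div (m d : nat) : nat := (m + d.-1) %/ d.

Lemma ceil_divE m d : 0 < d ->
  Posz (ceil_div m d) = Num.ceil (m%:R / d%:R : rat)%R.
Proof.
move=> d0; symmetry; apply: Num.Theory.ceil_def.
have d0' : (0 < d%:R :> rat)%R by rewrite Num.Theory.ltr0n.
rewrite Num.Theory.ltr_pdivlMr // Num.Theory.ler_pdivrMr //.
have -> : (d%:R = (Posz d)%:~R :> rat)%R by [].
have -> : (m%:R = (Posz m)%:~R :> rat)%R by [].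
rewrite -!GRing.rmorphM /= ltr_int ler_int.
have := divn_eq (m + d.-1) d; have := ltn_pmod (m + d.-1) d0.
rewrite /ceil_div; move: (_ %/ d) (_ %% d) => q s; nia.
Qed.

(* The general four-color formula p1 + ceil(p2/3) + ceil(p3/3) + ceil(p4/3) - 3
   gives 3 at (3,3,3,2), but a rainbow triangle shows that the value there is
   larger: (3,3,3,2) is exceptional for the same reason as (3,3,3). *)
Lemma not_PM_arrows_3332 : ~ PM_arrows 3 [tuple 3; 3; 3; 2].
Proof.
pose c (e : {set 'I_3}) : 'I_4 :=
  if ord0 \notin e then inord 0 else
  if inord 1 \notin e then inord 1 else inord 2.
move=> /(_ c) [i [M [/and3P[sM eM uM] oM]]].
have leM : pm_order M <= 3.
  by have := max_card (mem (flatten M)); rewrite (card_uniqP uM) card_ord.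
have c3 e : c e < 3 by rewrite /c; do 2?case: ifP => _; rewrite inordK.
case: M sM eM uM oM leM => [|P M] /=.
  by move=> _ _ _; case: i => [[|[|[|[|]]]]].
case/andP=> sP sM /andP[eP _] uM oM leM.
have i3 : i < 3.
  case: P sP eP {uM oM leM} => [|x [|y P]] //= _ /andP[/andP[_ /eqP <-] _].
  exact: c3.
have {}oM : 3 <= pm_order (P :: M).
  by move: oM; case: i i3 {eP} => [[|[|[|]]]].
have M0 : M = [::].
  case: M sM oM leM {uM} => // Q M /=; case/andP=> sQ _ _.
  rewrite /pm_order /= !size_cat; lia.
move: oM leM uM; rewrite {}M0 /pm_order /= cats0 {sM}.
case: P sP eP => [|x [|y [|z [|t P]]]] //= _.
case/and3P=> /andP[xy /eqP cxy] /andP[yz /eqP cyz] _ _ _ u.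
have {cyz} : c [set x; y] = c [set y; z] by rewrite cxy cyz.
move/(congr1 val); move: u; rewrite /c !inE -!val_eqE /= !inordK //.
case: x {xy cxy} => [[|[|[|x]]] ?] //; case: y {yz} => [[|[|[|y]]] ?] //;
by case: z => [[|[|[|z]]] ?] //=; rewrite ?inordK.
Qed.

(* Main.v *)
(* Upper bound.  A min-max theorem for path-matchings (a maximum one can be
   split into paths on 2 or 3 vertices, and alternating switches of endpoints
   of the 3-vertex paths produce the barrier) gives, for each color [i] without
   a path-matching of order [p_i], sets [A_i] and [S_i] with
   [|A_i| + 3 |S_i| < p_i] such that every edge of color [i] meets [S_i] or lies
   inside [A_i].  Conversely such sets covering all pairs define a coloring
   without the required path-matchings.  Off the union of the [S_i], the sets
   [A_i] cover all pairs of an [m]-set; looking at which blocks contain a given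
   vertex shows that with at most four blocks of sizes [b_i] and [m > 1] either
   [m <= b_i] for some [i], or [2m <= b_i + b_j + b_k] for some triple, or
   [3m <= 2b_i + b_j + b_k + b_l] for some [i], and the bound is arithmetic.
   Fewer colors are treated as four colors with empty blocks.

   Lower bound.  Take [A_1] of size [p_1 - 1], [S_i] of size [ceil(p_i/3) - 1]
   for [i > 1] and the other sets empty.  The exceptional cases come from the
   rainbow triangle and from the edges of K_4 colored as a triangle of color 1
   and three further edges of different colors. *)
Require Import Defs.
From mathcomp Require Import all_boot zify.

Set Implicit Arguments.
Unset Strict Implicit.
Unset Printing Implicit Defensive.

(** * Barriers and augmentation for path-matchings *)

Section MinMax.

Variables (T : finType) (e : rel T).
Hypotheses (e_sym : symmetric e) (e_irr : irreflexive e).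

(** The isolated vertices of the graph left after deleting [S]. *)
Definition isolated (S : {set T}) : {set T} :=
  [set x | (x \notin S) && [forall y, e x y ==> (y \in S)]].

Definition short_pm (M : seq (seq T)) :=
  path_matching e M && all (fun P => size P <= 3) M.

Definition center (M : seq (seq T)) (y : T) :=
  has (fun P => if P is [:: _; z; _] then z == y else false) M.

(* A step from [v] to [a]: replacing the 3-vertex path [a z b] by [v z b]
   covers [v] at the expense of [a]. *)
Definition switch (M : seq (seq T)) : rel T := fun v a =>
  has (fun P => if P is [:: b; z; d] then e v z && ((a == b) || (a == d))
                else false) M.

Arguments switch : simpl never.

(** The exchange behind every augmentation: [N] stays disjoint from the other paths because it only
    uses the vertices of [P] and the uncovered vertex [u]. *)
Lemma short_pm_replace u M P N :
    short_pm M -> P \in M -> u \notin flatten M ->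
    short_pm N -> {subset flatten N <= u :: P} ->
  short_pm (N ++ rem P M) /\
  pm_order (N ++ rem P M) + size P = pm_order N + pm_order M.
Proof.
rewrite /short_pm /path_matching => /andP[/and3P[sM oM uM] lM] PM uu.
move=> /andP[/and3P[sN oN uN] lN] sub.
have eM := perm_to_rem PM.
have eF : perm_eq (flatten M) (P ++ flatten (rem P M)).
  exact: (perm_flatten eM).
have all_rem a : all a M -> all a (rem P M).
  by move=> /allP aM; apply/allP => Q /mem_rem /aM.
split; last first.
  rewrite /pm_order (perm_size eF) flatten_cat !size_cat.
  by rewrite -addnA [size P + _]addnC.
rewrite !all_cat sN oN lN !all_rem // flatten_cat cat_uniq uN /= andbT.
move: uM uu; rewrite (perm_uniq eF) (perm_mem eF) cat_uniq mem_cat negb_or.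
move=> /and3P[_ dP ->] /andP[_ uR]; rewrite andbT.
apply/hasPn => x xR; apply/negP => /sub; rewrite inE => /orP[/eqP xu|xP].
  by move: uR; rewrite -xu xR.
by move/hasP: dP; apply; exists x.
Qed.

Lemma mem_two_paths (M : seq (seq T)) P Q x :
  uniq (flatten M) -> P \in M -> Q \in M -> x \in P -> x \in Q -> P = Q.
Proof.
move=> uM PM; rewrite (perm_mem (perm_to_rem PM)) inE => /orP[/eqP //|QM] xP xQ.
move: uM; rewrite (perm_uniq (perm_flatten (perm_to_rem PM))) /= cat_uniq.
case/and3P=> _ /hasP[]; exists x => //.
by apply/flattenP; exists Q.
Qed.

Lemma short_pm_uniq M P : short_pm M -> P \in M ->
  [/\ 1 < size P <= 3, sorted e P & uniq P].
Proof.
move=> /andP[/and3P[/allP sM /allP oM uM] /allP lM] PM.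
rewrite sM ?lM ?oM //; split=> //.
move: uM; rewrite (perm_uniq (perm_flatten (perm_to_rem PM))) /= cat_uniq.
by case/and3P.
Qed.

(** An uncovered [y] is joined to [u]; a 2-vertex path is extended by [u]; a 3-vertex path with end
    [y] is cut into the edge [u y] and the remaining edge. Only a center [y] resists. *)
Lemma augment_neighbor M u y : short_pm M -> u \notin flatten M -> e u y ->
  center M y \/ exists2 M', short_pm M' & pm_order M < pm_order M'.
Proof.
move=> sM uM uy.
have uNy : u != y by apply: contraTneq uy => ->; rewrite e_irr.
have [yM|yM] := boolP (y \in flatten M); last first.
  right; exists ([:: u; y] :: M); last by rewrite /pm_order /=; lia.
  case/andP: sM => /and3P[sM oM uniqM] lM.
  by rewrite /short_pm /path_matching /= sM oM uniqM lM uy !inE negb_or uNy uM yM.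
have {yM} [P PM yP] := flattenP yM.
have [zP oP uP] := short_pm_uniq sM PM.
have uNP : u \notin P.
  by apply: contra uM => uP'; apply/flattenP; exists P.
suff: center M y \/
    exists N, [/\ short_pm N, {subset flatten N <= u :: P} &
                  size P < pm_order N].
  case=> [|[N [sN subN ltN]]]; [by left | right].
  have [sM' oM'] := short_pm_replace sM PM uM sN subN.
  by exists (N ++ rem P M) => //; lia.
case: P zP oP uP PM yP uNP => [|a [|b [|d [|]]]] //= _.
  rewrite andbT => ab uP PM yP uNP; right.
  move: yP uNP uP; rewrite !inE !negb_or => /orP[] /eqP yE /andP[ua ub] aNb.
  - exists [:: [:: u; a; b]]; split=> //.
    + by rewrite /short_pm /path_matching /= -yE uy yE ab !inE negb_or ua ub aNb.
  - exists [:: [:: u; b; a]]; split=> //.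
    + rewrite /short_pm /path_matching /= -yE uy yE e_sym ab !inE negb_or ua ub.
      by rewrite eq_sym aNb.
    + by move=> x; rewrite !inE => /or3P[] ->; rewrite ?orbT.
rewrite andbT => /andP[ab bd] uP PM yP uNP.
move: uNP uP yP; rewrite !inE !negb_or.
case/and3P=> ua ub ud /and3P[/andP[aNb aNd] bNd _] /or3P[] /eqP yE.
- right; exists [:: [:: u; a]; [:: b; d]]; split=> //.
  rewrite /short_pm /path_matching /= -yE uy yE bd !inE !negb_or.
  by rewrite ua ub ud aNb aNd bNd.
- by left; apply/hasP; exists [:: a; b; d] => //=; rewrite yE.
- right; exists [:: [:: u; d]; [:: a; b]]; split=> //.
  + rewrite /short_pm /path_matching /= -yE uy yE ab !inE !negb_or.
    by rewrite ua ub ud aNb eq_sym aNd eq_sym bNd.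
  + by move=> x; rewrite !inE => /or4P[] ->; rewrite ?orbT.
Qed.

(** Induction on the alternating walk: its first switch leaves [a] uncovered instead of [u] at equal
    order, and the rest of the walk starts at [a]. The walk never returns to [a], so its other
    switches stay available. *)
Lemma augment M u p y :
    short_pm M -> u \notin flatten M -> path (switch M) u p -> uniq (u :: p) ->
    e (last u p) y ->
  center M y \/ exists2 M', short_pm M' & pm_order M < pm_order M'.
Proof.
elim: p M u => [|a p IHp] M u sM uM; first by move=> _ _; apply: augment_neighbor.
rewrite [path _ _ _]/= => /andP[/hasP[P PM]].
case: P PM => [|b [|z [|d [|]]]] // PM /andP[uz abd] pp upp ey.
have [_ oP uP] := short_pm_uniq sM PM.
(* [a'] is the end of the switched path that stays covered, so that the two orientations of the path
   are treated at once. *)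
have [a' [aPa ea' aNa' aNz zNa']] : exists a', [/\ [:: b; z; d] =i [:: a; z; a'],
    e z a', a != a', a != z & z != a'].
  move: oP uP => /= /and3P[bz zd _] /and3P[]; rewrite !inE negb_or.
  case/andP=> bNz bNd zNd _; case/orP: abd => /eqP ->; [exists d|exists b].
    by split.
  split; rewrite 1?[d == _]eq_sym 1?[z == b]eq_sym 1?e_sym //.
  by move=> x; rewrite !inE; case: (x == b); case: (x == z); case: (x == d).
have PsubM x : x \in [:: a; z; a'] -> x \in flatten M.
  by rewrite -aPa => xP; apply/flattenP; exists [:: b; z; d].
have aM : a \in flatten M by rewrite PsubM ?inE ?eqxx.
have uNP x : x \in [:: a; z; a'] -> u != x.
  by move=> /PsubM xM; apply: contraNneq uM => ->.
have sN : short_pm [:: [:: u; z; a']].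
  rewrite /short_pm /path_matching /= uz ea' !inE negb_or !uNP ?inE ?eqxx ?orbT //.
  by rewrite zNa'.
have subN : {subset flatten [:: [:: u; z; a']] <= u :: [:: b; z; d]}.
  by move=> x; rewrite [x \in u :: _]in_cons aPa !inE => /or3P[] ->; rewrite ?orbT.
have [sM' oM'] := short_pm_replace sM PM uM sN subN.
set M' := _ ++ _ in sM' oM'.
have aM' : a \notin flatten M'.
  rewrite mem_cat !inE !negb_or eq_sym uNP ?inE ?eqxx // aNz aNa' /=.
  have uF : uniq ([:: b; z; d] ++ flatten (rem [:: b; z; d] M)).
    rewrite -(perm_uniq (perm_flatten (perm_to_rem PM))).
    by case/andP: sM => /and3P[].
  have aP : a \in [:: b; z; d] by rewrite aPa inE eqxx.
  move: uF; rewrite cat_uniq => /and3P[_ /hasPn dis _].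
  by apply/negP => /dis; rewrite /= aP.
(* A switch through the replaced path must go to [a'], which is still an end of [[:: u; z; a']]; all
   other paths are unchanged. *)
have swM' v w : w != a -> switch M v w -> switch M' v w.
  move=> wNa /hasP[Q QM]; case: (Q =P [:: b; z; d]) => [->|/eqP QNP].
    case/andP=> vz wP; rewrite /switch /= vz /=.
    have : w \in [:: b; z; d] by rewrite !inE; case/orP: wP => ->; rewrite ?orbT.
    rewrite aPa !inE (negPf wNa) /= => /orP[/eqP wz|->]; last by rewrite orbT.
    move: wP uP; rewrite wz /= !inE => /orP[] /eqP ->; rewrite ?eqxx ?andbF //.
  move=> Qw; apply/hasP; exists Q => //.
  move: QM; rewrite (perm_mem (perm_to_rem PM)) inE (negPf QNP) /=.
  by rewrite inE orbC => ->.
have pp' : path (switch M') a p.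
  have: a \notin p by case/and3P: upp.
  elim: (p) {1 3}a pp => //= w q IH v /andP[vw wq].
  by rewrite inE negb_or eq_sym => /andP[wa aq]; rewrite swM' //= IH.
have [||cM'|[M'' sM'' ltM'']] := IHp M' a sM' aM' pp'.
- by case/andP: upp.
- exact: ey.
- left; move: cM'; rewrite /center /= => /orP[/eqP <-|].
    by apply/hasP; exists [:: b; z; d] => //=.
  by move=> /hasP[Q /mem_rem QM Qy]; apply/hasP; exists Q.
- right; exists M'' => //; apply: leq_ltn_trans ltM''.
  by move: (oM' : pm_order M' + 3 = 3 + pm_order M); clear; lia.
Qed.

(** Let [X] be what switches reach from the uncovered set [U], and [S] the neighbors of [X]. A
    non-center in [S] permits an augmentation. Otherwise [X] is isolated by [S], and the paths
    centered in [S] have their [3 * #|S|] or more vertices in [S] and [X :\: U], whence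
    [#|X| >= #|U| + 2 * #|S|]. *)
Lemma minmax_or_augment M : short_pm M ->
  (exists S : {set T}, #|T| + 2 * #|S| <= pm_order M + #|isolated S|) \/
  exists2 M', short_pm M' & pm_order M < pm_order M'.
Proof.
move=> sM.
pose U := [set u | u \notin flatten M].
pose X := [set v | [exists u in U, connect (switch M) u v]].
pose S := [set y | [exists v in X, e v y]].
have [/existsP[y /andP[yS yM]]|noaug] := boolP [exists y in S, ~~ center M y].
  move: yS; rewrite inE => /exists_inP[v]; rewrite inE => /exists_inP[u].
  rewrite inE => uM /connectP[p pp ->]; case/shortenP: pp => q qp uq _ ey.
  by right; case: (augment sM uM qp uq ey) yM => [->|].
have {noaug} cS y : y \in S -> center M y.
  by move=> yS; apply: contraNT noaug => yM; apply/exists_inP; exists y.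
left; exists S.
have uM : uniq (flatten M) by case/andP: sM => /and3P[].
have sub : X \subset isolated S.
  apply/subsetP => v vX; rewrite inE; apply/andP; split; last first.
    by apply/forall_inP => y vy; rewrite inE; apply/exists_inP; exists v.
  (* A vertex of [X] is uncovered or an end of a 3-vertex path, hence never a center. *)
  apply/negP => /cS /hasP[[|a [|z [|b [|]]]] //= PM /eqP zv].
  have vP : v \in [:: a; z; b] by rewrite zv !inE eqxx orbT.
  move: vX; rewrite inE => /exists_inP[u uU /connectP[p]].
  case/lastP: p => [_ /= vu|p w].
    move: uU; rewrite inE -vu => /flattenP[]; by exists [:: a; z; b].
  rewrite last_rcons rcons_path => /andP[_ /hasP[Q QM]] wQ vw.
  move: wQ.
  case: Q QM => [|b' [|z' [|d' [|]]]] // QM /andP[_ wQ].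
  have wQ' : v \in [:: b'; z'; d'].
    by rewrite vw !inE; case/orP: wQ => ->; rewrite ?orbT.
  have [_ _ uP] := short_pm_uniq sM PM.
  have [aE zE bE] := mem_two_paths uM PM QM vP wQ'.
  move: uP wQ; rewrite -aE -bE -vw -zv /= !inE.
  by move=> uP /orP[] /eqP zE'; move: uP; rewrite zE' eqxx ?andbF.
have UX : U \subset X.
  by apply/subsetP => u uU; rewrite inE; apply/exists_inP; exists u.
have cardU : #|U| + pm_order M = #|T|.
  rewrite /pm_order -(card_uniqP uM) -[RHS](cardC (mem (flatten M))) addnC.
  by congr (_ + _); apply: eq_card => x; rewrite !inE.
pose inS (P : seq T) := if P is [:: _; z; _] then z \in S else false.
pose MS := filter inS M.
have size3 : size (flatten MS) = 3 * size MS.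
  have: all inS MS by apply: filter_all.
  elim: MS => //= P MS' IH /andP[iP /IH sz]; rewrite size_cat sz.
  by case: P iP => [|? [|? [|? [|]]]] //= _; lia.
have uMS : uniq (flatten MS).
  move: uM; rewrite /MS; elim: (M) => //= P M' IH; rewrite cat_uniq.
  case/and3P=> uP /hasPn dP /IH uM'; case: ifP => //= _.
  rewrite cat_uniq uP uM' andbT; apply/hasPn => x /flattenP[Q].
  rewrite mem_filter => /andP[_ QM'] xQ; apply: dP.
  by apply/flattenP; exists Q.
pose mid (P : seq T) := if P is [:: _; z; _] then Some z else None.
have leS : #|S| <= size MS.
  rewrite cardE -(size_map Some) -(size_map mid).
  apply: uniq_leq_size; first by rewrite map_inj_uniq ?enum_uniq // => ? ? [].
  move=> _ /mapP[y yS ->]; rewrite mem_enum in yS.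
  have /hasP[[|a [|z [|d [|]]]] //= PM /eqP zy] := cS y yS.
  apply/mapP; exists [:: a; z; d]; rewrite /= ?zy //.
  by rewrite mem_filter -zy /= PM zy yS.
(* Both ends of a path centered in [S] are one switch away from a vertex of [X], so they lie in [X]
   too. *)
have subMS : {subset flatten MS <= S :|: (X :\: U)}.
  move=> x /flattenP[P]; rewrite mem_filter => /andP[iP PM] xP.
  case: P iP PM xP => [|a [|z [|d [|]]]] //= zS PM xP.
  have xM : x \in flatten M by apply/flattenP; exists [:: a; z; d].
  rewrite in_setU in_setD [x \in U]inE xM /=.
  have [->|xz] := eqVneq x z; first by rewrite zS.
  apply/orP; right; move: zS; rewrite inE => /exists_inP[v vX vz].
  move: vX; rewrite !inE => /exists_inP[u uU uv]; apply/exists_inP; exists u => //.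
  apply: connect_trans uv (connect1 _); apply/hasP; exists [:: a; z; d] => //.
  by move: xP; rewrite vz !inE (negPf xz).
have leMS : 3 * size MS <= #|S| + #|X :\: U|.
  rewrite -size3 -(card_uniqP uMS) -cardsUI.
  apply: leq_trans (leq_addr _ _); apply: subset_leq_card.
  by apply/subsetP => x; apply: subMS.
have := subset_leq_card sub; have := cardsD X U; have := subset_leq_card UX.
rewrite (setIidPr UX); lia.
Qed.

Lemma path_matching_minmax : exists M (S : {set T}),
  path_matching e M /\ #|T| + 2 * #|S| <= pm_order M + #|isolated S|.
Proof.
suff H k M : short_pm M -> #|T| - pm_order M <= k -> exists M' (S : {set T}),
    path_matching e M' /\ #|T| + 2 * #|S| <= pm_order M' + #|isolated S|.
  exact: (H #|T| [::] isT (leq_subr _ _)).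
elim: k M => [|k IHk] M sM leM;
  have [[S leS]|[M' sM' ltM']] := minmax_or_augment sM;
  try by exists M, S; split=> //; case/andP: sM.
all: have : pm_order M' <= #|T|
       by case/andP: sM' => /and3P[_ _ /card_uniqP uM'] _; rewrite /pm_order -uM' max_card.
  by lia.
by move=> leM'; apply: (IHk M' sM'); lia.
Qed.
End MinMax.

(** * Colorings without large path-matchings as block covers *)

(** Along a path, every vertex outside [A] and [S] has a neighbor in [S], and each vertex of [S] is
    charged at most twice; so there are at most [2 * #|S|] such vertices, besides at most
    [#|A| + #|S|] others. *)
Lemma path_matching_le (T : finType) (e : rel T) (A S : {set T}) M :
    (forall x y, e x y -> [|| x \in S, y \in S | (x \in A) && (y \in A)]) ->
  path_matching e M -> pm_order M <= #|A| + 3 * #|S|.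
Proof.
move=> eAS /and3P[sM oM uM].
pose O := [predC (A :|: S)].
suff leO : count O (flatten M) <= 2 * count (mem S) (flatten M).
  rewrite /pm_order -(count_predC O).
  have le1 (B : {set T}) : count (mem B) (flatten M) <= #|B|.
    rewrite -size_filter; have /card_uniqP <- := filter_uniq (mem B) uM.
    by apply: subset_leq_card; apply/subsetP => x; rewrite mem_filter => /andP[].
  have : count (predC O) (flatten M) <= #|A| + #|S|.
    apply: leq_trans (leq_add (le1 A) (le1 S)); rewrite -count_predUI.
    apply: leq_trans (leq_addr _ _); apply: sub_count => x.
    by rewrite /= negbK in_setU.
  have := le1 S; lia.
elim: M sM oM {uM} => //= P M IH /andP[sP sM] /andP[oP oM].
have {IH} := IH sM oM; rewrite !count_cat.
suff : count O P <= 2 * count (mem S) P by lia.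
(* If the head [x] is in [S], one of its two charges is reserved for its predecessor; if [x] is in
   [O], it may still be charged to that predecessor. *)
have inv x Q : path e x Q -> count O (x :: Q) + (x \in S) <=
    2 * count (mem S) (x :: Q) + O x.
  elim: Q x => [|y Q IH] x; first by rewrite /= inE; case: (x \in S); lia.
  rewrite [path _ _ _]/= => /andP[/eAS xy /IH].
  rewrite /= !inE /=; move: xy.
  by case: (x \in A); case: (y \in A); case: (x \in S); case: (y \in S) => //=; lia.
case: P sP oP => [|x [|y P]] // _; rewrite [sorted _ _]/= => /andP[/eAS xy /inv].
move: xy; rewrite /= !inE.
by case: (x \in A); case: (y \in A); case: (x \in S); case: (y \in S) => //=; lia.
Qed.

(* A witness that [p] is not arrowed, with the colors left implicit. *)
Definition block_cover (T : finType) r (p : r.-tuple nat)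
    (A S : 'I_r -> {set T}) : Prop :=
  (forall i, #|A i| + 3 * #|S i| < tnth p i) /\
  (forall x y, x != y ->
     exists i, [|| x \in S i, y \in S i | (x \in A i) && (y \in A i)]).

Lemma card_isolated_compl (T : finType) (e : rel T) (S : {set T}) q :
    #|T| + 2 * #|S| < q + #|isolated e S| ->
  #|~: (isolated e S :|: S)| + 3 * #|S| < q.
Proof.
have dis : isolated e S :&: S = set0.
  by apply/setP => x; rewrite !inE; case: (x \in S); rewrite ?andbF.
have := cardsC (isolated e S :|: S).
by have := cardsUI (isolated e S) S; rewrite dis cards0; lia.
Qed.

(** If every color had a barrier in [good], these barriers would form a block cover, with [A i] the
    vertices neither in [S i] nor isolated by it. So some color has none, and there the min-max
    inequality yields a path-matching of the required order. *)
Lemma PM_arrows_block_cover n r (p : r.-tuple nat) :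
  ~ (exists (A S : 'I_r -> {set 'I_n}), block_cover p A S) -> PM_arrows n p.
Proof.
move=> noAS c; pose e i := color_class c i.
pose good i (S : {set 'I_n}) := n + 2 * #|S| < tnth p i + #|isolated (e i) S|.
have [/forallP all_good|] := boolP [forall i, exists S, good i S].
  case: noAS; have [S gS] := fin_all_exists (fun i => existsP (all_good i)).
  exists (fun i => ~: (isolated (e i) (S i) :|: S i)), S; split=> [i|x y xy].
    apply: card_isolated_compl; rewrite card_ord; exact: gS.
  exists (c [set x; y]); rewrite !inE.
  case xS: (x \in S _) => //=; case yS: (y \in S _) => //=; rewrite !orbF.
  have exy : e (c [set x; y]) x y by apply/andP; rewrite eqxx.
  have eyx : e (c [set x; y]) y x by apply/andP; rewrite eq_sym setUC eqxx.
  apply/andP; split; apply/forallPn; [exists y|exists x].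
    by rewrite exy yS.
  by rewrite eyx xS.
rewrite negb_forall => /existsP[i /existsPn nogood]; exists i.
have [||M [S [pmM leM]]] := @path_matching_minmax _ (e i).
- by move=> x y; apply/andP/andP; rewrite eq_sym setUC.
- by move=> x; apply/andP; rewrite eqxx; case.
exists M; split=> //; rewrite -(leq_add2r #|isolated (e i) S|).
by apply: leq_trans leM; rewrite card_ord leqNgt; apply: nogood.
Qed.

Lemma block_cover_not_PM_arrows n r (p : r.+1.-tuple nat)
    (A S : 'I_r.+1 -> {set 'I_n}) :
  block_cover p A S -> ~ PM_arrows n p.
Proof.
case=> leAS cov.
pose good (E : {set 'I_n}) i :=
  [forall x in E, forall y in E, (x != y) ==>
     [|| x \in S i, y \in S i | (x \in A i) && (y \in A i)]].
(* The default [ord0] is only reached on sets that are not edges, since [cov] gives every edge a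
   good color. *)
pose c : coloring n r.+1 := fun E => odflt ord0 [pick i | good E i].
move=> /(_ c) [i [M [pmM]]]; apply/negP; rewrite -ltnNge.
apply: leq_ltn_trans (leAS i); apply: path_matching_le pmM => x y /=.
case/andP=> xy /eqP; rewrite /c; case: pickP => [j + <- | nogood] /=.
  by move/forall_inP/(_ x (set21 _ _))/forall_inP/(_ y (set22 _ _)); rewrite xy.
have [j covj] := cov x y xy; have /negP[] := nogood j.
apply/forall_inP => a aE; apply/forall_inP => b bE; apply/implyP.
case/set2P: aE => ->; case/set2P: bE => ->; rewrite ?eqxx // => _.
by move: covj; case: (x \in S j) (y \in S j) => [] []; rewrite // andbC.
Qed.

Lemma block_cover_preimset (T T' : finType) (f : T -> T') r (p : r.-tuple nat) A S :
  injective f -> block_cover p A S ->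
  block_cover p (fun i => f @^-1: A i) (fun i => f @^-1: S i).
Proof.
move=> f_inj [leAS cov]; split=> [i|x y xy].
  apply: leq_ltn_trans (leAS i).
  by rewrite leq_add ?leq_mul // -(card_imset _ f_inj) subset_leq_card //;
    apply/subsetP => _ /imsetP[x + ->]; rewrite inE.
have [|i ci] := cov (f x) (f y); first by rewrite (inj_eq f_inj).
by exists i; rewrite !inE.
Qed.

(** Covers restrict along injections, so one cover excludes all smaller complete graphs, as
    minimality in [is_RPM] requires. *)
Lemma not_PM_arrows_le (T : finType) n r (p : r.+1.-tuple nat) A S :
  @block_cover T _ p A S -> n <= #|T| -> ~ PM_arrows n p.
Proof.
move=> cov nT.
have f_inj : injective (fun i : 'I_n => enum_val (widen_ord nT i)).
  by move=> i j /enum_val_inj /(congr1 val) /= /val_inj.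
exact: block_cover_not_PM_arrows (block_cover_preimset f_inj cov).
Qed.

Lemma block_cover_is_RPM (T : finType) n r (p : r.+1.-tuple nat) A S :
    @block_cover T _ p A S -> n = #|T|.+1 ->
    (forall A' S' : 'I_r.+1 -> {set 'I_n}, ~ block_cover p A' S') ->
  is_RPM p n.
Proof.
move=> cov nT nocov; split=> [|m arr].
  by apply: PM_arrows_block_cover => -[A' [S' /nocov]].
by rewrite nT ltnNge; apply: contraPN arr; apply: not_PM_arrows_le cov.
Qed.

(** * The general lower-bound construction *)

Section GeneralCover.

Variables (r : nat) (p : r.+1.-tuple nat).
Hypothesis p_gt0 : forall i, 0 < tnth p i.

(** For a positive [p_i], [(tnth p i).-1 %/ 3] is ceil(p_i/3) - 1, the largest [s] with
    [3 * s < tnth p i]. *)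
Definition part_size (i : 'I_r.+1) :=
  if i == ord0 then (tnth p i).-1 else (tnth p i).-1 %/ 3.
Definition part_type := {i : 'I_r.+1 & 'I_(part_size i)}.

Lemma card_part (i : 'I_r.+1) : #|[set x : part_type | tag x == i]| = part_size i.
Proof.
rewrite -[RHS]card_ord -(card_imset _ (@eq_from_Tagged _ (fun j => 'I_(part_size j)) i)).
apply: eq_card => x; rewrite inE; apply/eqP/imsetP.
  by case: x => j x /= <-; exists x.
by case=> y _ ->.
Qed.

Lemma card_part_type : #|{: part_type}| = \sum_i part_size i.
Proof.
rewrite card_tagged sumnE big_map big_enum /=.
by apply: eq_bigr => i _; rewrite card_ord.
Qed.

Lemma part_block_cover : block_cover p
  (fun i => if i == ord0 then [set x : part_type | tag x == i] else set0)
  (fun i => if i == ord0 then set0 else [set x : part_type | tag x == i]).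
Proof.
split=> [i|x y _].
  have := p_gt0 i; case: ifP => i0; rewrite cards0 card_part /part_size i0; lia.
have [x0|xn0] := eqVneq (tag x) ord0; last first.
  by exists (tag x); rewrite (negPf xn0) inE eqxx.
have [y0|yn0] := eqVneq (tag y) ord0; last first.
  by exists (tag y); rewrite (negPf yn0) !inE eqxx orbT.
by exists ord0; rewrite !inE x0 y0.
Qed.

End GeneralCover.


(** * Covering all pairs of a set by four blocks *)

Section FourBlocks.

Variables (T : finType) (X B1 B2 B3 B4 : {set T}).

Definition weight (w1 w2 w3 w4 : nat) (x : T) :=
  w1 * (x \in B1) + w2 * (x \in B2) + w3 * (x \in B3) + w4 * (x \in B4).

(** Averaging: the weights of the points of [X] sum to at most the weighted sum of the block
    sizes. *)
Lemma exists_light k w1 w2 w3 w4 :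
    ~~ (k * #|X| <= w1 * #|B1| + w2 * #|B2| + w3 * #|B3| + w4 * #|B4|) ->
  exists2 x, x \in X & weight w1 w2 w3 w4 x < k.
Proof.
move=> nk; apply/exists_inP; apply: contraR nk => /exists_inPn heavy.
have sumB w (B : {set T}) : \sum_(x in X) w * (x \in B) <= w * #|B|.
  rewrite -big_distrr leq_mul //= -sum1_card [leqRHS]big_mkcond /=.
  rewrite [leqLHS]big_mkcond leq_sum // => x _.
  by case: (x \in X); case: (x \in B).
apply: leq_trans (leq_add (leq_add (leq_add (sumB w1 B1) (sumB w2 B2))
  (sumB w3 B3)) (sumB w4 B4)).
rewrite -!big_split mulnC -sum_nat_const leq_sum //= => x /heavy.
by rewrite -leqNgt.
Qed.

Hypothesis pair_cov : forall x y, x \in X -> y \in X -> x != y ->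
  [|| (x \in B1) && (y \in B1), (x \in B2) && (y \in B2),
      (x \in B3) && (y \in B3) | (x \in B4) && (y \in B4)].

(** If every inequality fails, averaging provides vertices lying in exactly two blocks whose types
    are pairwise intersecting 2-subsets of the four blocks. Such a family is a star or lies in a
    triangle: [y_i] excludes the star at [i], and [x_i] the triangle avoiding [i]. *)
Lemma four_blocks (m := #|X|) (b1 := #|B1|) (b2 := #|B2|) (b3 := #|B3|)
    (b4 := #|B4|) :
  [|| m <= 1,
      [|| m <= b1, m <= b2, m <= b3 | m <= b4],
      [|| 2 * m <= b1 + b2 + b3, 2 * m <= b1 + b2 + b4,
          2 * m <= b1 + b3 + b4 | 2 * m <= b2 + b3 + b4] |
      [|| 3 * m <= 2 * b1 + b2 + b3 + b4, 3 * m <= b1 + 2 * b2 + b3 + b4,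
          3 * m <= b1 + b2 + 2 * b3 + b4 | 3 * m <= b1 + b2 + b3 + 2 * b4]].
Proof.
apply/norP => -[m1 /norP[full /norP[triple star]]].
(* As [m > 1], each vertex lies in a block, so the covering also holds for [x = y]; the witnesses
   below need not be distinct. *)
have cov x y : x \in X -> y \in X ->
    [|| (x \in B1) && (y \in B1), (x \in B2) && (y \in B2),
        (x \in B3) && (y \in B3) | (x \in B4) && (y \in B4)].
  move=> xX yX; have [<-|] := eqVneq x y; last exact: pair_cov.
  have [z /andP[zX xz]] : exists z, (z \in X) && (x != z).
    move: m1; rewrite -ltnNge => /card_gt1P[z1 [z2 [z1X z2X z12]]].
    have [->|xz1] := eqVneq x z1; first by exists z2; rewrite z2X.
    by exists z1; rewrite z1X.
  have := pair_cov xX zX xz.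
  by case: (x \in B1) (x \in B2) (x \in B3) (x \in B4) => [] [] [] [].
have light k w1 w2 w3 w4 := @exists_light k w1 w2 w3 w4.
(* A vertex lying only in block [i] would share no block with the vertex [z_i] outside block [i]. *)
have heavy2 x : x \in X -> 2 <= weight 1 1 1 1 x.
  move=> xX; case/norP: full => f1 /norP[f2 /norP[f3 f4]].
  have [|z1 /(cov x _ xX) + z1N] := light 1 1 0 0 0; first by move: f1; clear; lia.
  have [|z2 /(cov x _ xX) + z2N] := light 1 0 1 0 0; first by move: f2; clear; lia.
  have [|z3 /(cov x _ xX) + z3N] := light 1 0 0 1 0; first by move: f3; clear; lia.
  have [|z4 /(cov x _ xX) + z4N] := light 1 0 0 0 1; first by move: f4; clear; lia.
  move: z1N z2N z3N z4N; rewrite /weight.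
  case: (z1 \in B1) => // _; case: (z2 \in B2) => // _.
  case: (z3 \in B3) => // _; case: (z4 \in B4) => // _.
  by case: (x \in B1); case: (x \in B2); case: (x \in B3); case: (x \in B4);
    rewrite ?andbF.
(* [x_i] lies in block [i] and [y_i] does not; each lies in exactly two blocks.
   As pairs of blocks these eight types would have to intersect pairwise. *)
case/norP: triple => t4 /norP[t3 /norP[t2 t1]].
case/norP: star => s1 /norP[s2 /norP[s3 s4]].
have [|x4 x4X x4l] := light 2 1 1 1 0; first by move: t4; clear; lia.
have [|x3 x3X x3l] := light 2 1 1 0 1; first by move: t3; clear; lia.
have [|x2 x2X x2l] := light 2 1 0 1 1; first by move: t2; clear; lia.
have [|x1 x1X x1l] := light 2 0 1 1 1; first by move: t1; clear; lia.
have [|y1 y1X y1l] := light 3 2 1 1 1; first by move: s1; clear; lia.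
have [|y2 y2X y2l] := light 3 1 2 1 1; first by move: s2; clear; lia.
have [|y3 y3X y3l] := light 3 1 1 2 1; first by move: s3; clear; lia.
have [|y4 y4X y4l] := light 3 1 1 1 2; first by move: s4; clear; lia.
move: (heavy2 _ x3X) x3l (cov _ _ x4X x3X) (cov _ _ y4X x3X) (cov _ _ y2X x3X)
  (cov _ _ y1X x3X).
move: (heavy2 _ x2X) x2l (cov _ _ x4X x2X) (cov _ _ y4X x2X) (cov _ _ y3X x2X)
  (cov _ _ y1X x2X).
move: (heavy2 _ x1X) x1l (cov _ _ x4X x1X) (cov _ _ y4X x1X) (cov _ _ y3X x1X)
  (cov _ _ y2X x1X).
move: (heavy2 _ y1X) y1l (cov _ _ x4X y1X) (cov _ _ y4X y1X) (cov _ _ y3X y1X)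
  (cov _ _ y2X y1X).
move: (heavy2 _ y2X) y2l (cov _ _ x4X y2X) (cov _ _ y4X y2X) (cov _ _ y3X y2X).
move: (heavy2 _ y3X) y3l (cov _ _ x4X y3X) (cov _ _ y4X y3X).
move: (heavy2 _ y4X) y4l (cov _ _ x4X y4X).
move: (heavy2 _ x4X) x4l.
rewrite /weight {cov light heavy2}.
case: (x4 \in B1) (x4 \in B2) (x4 \in B3) (x4 \in B4) => [] [] [] [] //= _ _.
all: case: (y4 \in B1) (y4 \in B2) (y4 \in B3) (y4 \in B4) => [] [] [] [] //= _ _ _.
all: case: (y3 \in B1) (y3 \in B2) (y3 \in B3) (y3 \in B4) => [] [] [] [] //= _ _ _ _.
all: case: (y2 \in B1) (y2 \in B2) (y2 \in B3) (y2 \in B4) => [] [] [] [] //= _ _ _ _ _.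
all: case: (y1 \in B1) (y1 \in B2) (y1 \in B3) (y1 \in B4) => [] [] [] [] //= _ _ _ _ _ _.
all: case: (x1 \in B1) (x1 \in B2) (x1 \in B3) (x1 \in B4) => [] [] [] [] //= _ _ _ _ _ _.
all: case: (x2 \in B1) (x2 \in B2) (x2 \in B3) (x2 \in B4) => [] [] [] [] //= _ _ _ _ _ _.
all: case: (x3 \in B1) (x3 \in B2) (x3 \in B3) (x3 \in B4) => [] [] [] [] //= _ _ _ _ _ _.
Qed.
End FourBlocks.

(** * Arithmetic of the upper bound *)

(** Here [q_i] stands for p_i - 1. These are the sizes at which the rainbow triangle or the colored
    K_4 has one vertex more than the general construction; the free [q4] lets the first case serve
    three colors as well as four. *)
Definition exceptional q1 q2 q3 q4 :=
  [&& q1 == 2, q2 == 2 & q3 == 2] || [&& q1 == 3, q2 == 2, q3 == 2 & q4 == 2].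

(** The cases [m <= 1] and [m <= b_i] already give the general bound; rounding in the two averaged
    families exceeds it, by one, only at the [exceptional] sizes. *)
Lemma four_blocks_arith n m q1 q2 q3 q4 s1 s2 s3 s4 b1 b2 b3 b4 :
    b1 + 3 * s1 <= q1 -> b2 + 3 * s2 <= q2 ->
    b3 + 3 * s3 <= q3 -> b4 + 3 * s4 <= q4 ->
    q4 <= q3 -> q3 <= q2 -> q2 <= q1 -> 0 < q1 -> n <= m + (s1 + s2 + s3 + s4) ->
    [|| m <= 1,
      [|| m <= b1, m <= b2, m <= b3 | m <= b4],
      [|| 2 * m <= b1 + b2 + b3, 2 * m <= b1 + b2 + b4,
          2 * m <= b1 + b3 + b4 | 2 * m <= b2 + b3 + b4] |
      [|| 3 * m <= 2 * b1 + b2 + b3 + b4, 3 * m <= b1 + 2 * b2 + b3 + b4,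
          3 * m <= b1 + b2 + 2 * b3 + b4 | 3 * m <= b1 + b2 + b3 + 2 * b4]] ->
  n <= q1 + q2 %/ 3 + q3 %/ 3 + q4 %/ 3 + exceptional q1 q2 q3 q4.
Proof.
rewrite /exceptional => h1 h2 h3 h4 l43 l32 l21 q1_gt0 nm.
case/or4P=> [h|/or4P[] h|/or4P[] h|/or4P[] h].
all: lia.
Qed.

Lemma block_cover_card (T : finType) (A1 A2 A3 A4 S1 S2 S3 S4 : {set T})
    q1 q2 q3 q4 :
    #|A1| + 3 * #|S1| <= q1 -> #|A2| + 3 * #|S2| <= q2 ->
    #|A3| + 3 * #|S3| <= q3 -> #|A4| + 3 * #|S4| <= q4 ->
    q4 <= q3 -> q3 <= q2 -> q2 <= q1 -> 0 < q1 ->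
    (forall x y, x != y ->
      [|| [|| x \in S1, y \in S1 | (x \in A1) && (y \in A1)],
          [|| x \in S2, y \in S2 | (x \in A2) && (y \in A2)],
          [|| x \in S3, y \in S3 | (x \in A3) && (y \in A3)] |
          [|| x \in S4, y \in S4 | (x \in A4) && (y \in A4)]]) ->
  #|T| <= q1 + q2 %/ 3 + q3 %/ 3 + q4 %/ 3 + exceptional q1 q2 q3 q4.
Proof.
move=> h1 h2 h3 h4 l43 l32 l21 q1_gt0 cov.
pose S := S1 :|: S2 :|: S3 :|: S4.
apply: (four_blocks_arith h1 h2 h3 h4 l43 l32 l21 q1_gt0 (m := #|~: S|)).
  have leU (B C : {set T}) : #|B :|: C| <= #|B| + #|C| by rewrite cardsU leq_subr.
  rewrite -(cardsC S) addnC leq_add2l.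
  by do 2!(apply: leq_trans (leU _ _) _; rewrite leq_add2r).
apply: four_blocks => x y; rewrite !inE !negb_or.
move=> /andP[/andP[/andP[/negPf x1 /negPf x2] /negPf x3] /negPf x4].
move=> /andP[/andP[/andP[/negPf y1 /negPf y2] /negPf y3] /negPf y4] /cov.
by rewrite x1 x2 x3 x4 y1 y2 y3 y4.
Qed.

Lemma is_RPM_of_part_size r (p : r.+1.-tuple nat) n :
    (forall i, 0 < tnth p i) -> n = (\sum_i part_size p i).+1 ->
    (forall A S : 'I_r.+1 -> {set 'I_n}, ~ block_cover p A S) ->
  is_RPM p n.
Proof.
move=> p_gt0 nE; apply: (block_cover_is_RPM (part_block_cover p_gt0)).
by rewrite card_part_type.
Qed.

Lemma exists_ord_or n (P : pred 'I_n) : (exists i, P i) -> \big[orb/false]_i P i.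
Proof. by move=> /existsP; rewrite big_orE. Qed.

Lemma no_block_cover4 n p1 p2 p3 p4 A S :
    p1 >= p2 -> p2 >= p3 -> p3 >= p4 -> p4 >= 2 ->
    p1 + ceil_div p2 3 + ceil_div p3 3 + ceil_div p4 3 - 3
      + exceptional p1.-1 p2.-1 p3.-1 p4.-1 <= n ->
  ~ @block_cover 'I_n _ [tuple p1; p2; p3; p4] A S.
Proof.
rewrite /ceil_div => le21 le32 le43 p4_ge2 len [leAS cov].
(* The colors are written as the iterated [lift]s that [big_ord_recl] produces when unfolding the
   covering condition. *)
pose i1 : 'I_4 := lift ord0 ord0; pose i2 : 'I_4 := lift ord0 (lift ord0 ord0).
pose i3 : 'I_4 := lift ord0 (lift ord0 (lift ord0 ord0)).
have := @block_cover_card _ (A ord0) (A i1) (A i2) (A i3)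
  (S ord0) (S i1) (S i2) (S i3) p1.-1 p2.-1 p3.-1 p4.-1.
have := leAS ord0; have := leAS i1; have := leAS i2; have := leAS i3.
rewrite /tnth /= card_ord => l4 l3 l2 l1 H.
suff : n <= p1.-1 + p2.-1 %/ 3 + p3.-1 %/ 3 + p4.-1 %/ 3 +
    exceptional p1.-1 p2.-1 p3.-1 p4.-1 by lia.
apply: H => [||||||||x y /cov /exists_ord_or]; last first.
  by rewrite !big_ord_recl big_ord0 orbF.
all: by clear cov; lia.
Qed.

Lemma no_block_cover3 n p1 p2 p3 A S :
    p1 >= p2 -> p2 >= p3 -> p3 >= 2 ->
    p1 + ceil_div p2 3 + ceil_div p3 3 - 2
      + exceptional p1.-1 p2.-1 p3.-1 0 <= n ->
  ~ @block_cover 'I_n _ [tuple p1; p2; p3] A S.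
Proof.
rewrite /ceil_div => le21 le32 p3_ge2 len [leAS cov].
pose i1 : 'I_3 := lift ord0 ord0; pose i2 : 'I_3 := lift ord0 (lift ord0 ord0).
have := @block_cover_card _ (A ord0) (A i1) (A i2) set0
  (S ord0) (S i1) (S i2) set0 p1.-1 p2.-1 p3.-1 0.
have := leAS ord0; have := leAS i1; have := leAS i2.
rewrite /tnth /= card_ord cards0 => l3 l2 l1 H.
suff : n <= p1.-1 + p2.-1 %/ 3 + p3.-1 %/ 3 + 0 %/ 3 +
    exceptional p1.-1 p2.-1 p3.-1 0 by lia.
apply: H => [||||||||x y /cov /exists_ord_or]; last first.
  by rewrite !big_ord_recl big_ord0 !inE !orbF.
all: by clear cov; lia.
Qed.

Lemma no_block_cover2 n p1 p2 A S :
    p1 >= p2 -> p2 >= 2 -> p1 + ceil_div p2 3 - 1 <= n ->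
  ~ @block_cover 'I_n _ [tuple p1; p2] A S.
Proof.
rewrite /ceil_div => le21 p2_ge2 len [leAS cov].
pose i1 : 'I_2 := lift ord0 ord0.
have := @block_cover_card _ (A ord0) (A i1) set0 set0
  (S ord0) (S i1) set0 set0 p1.-1 p2.-1 0 0.
have := leAS ord0; have := leAS i1.
rewrite /tnth /= card_ord cards0 /exceptional => l2 l1 H.
suff : n <= p1.-1 + p2.-1 %/ 3 by lia.
apply: leq_trans (H _ _ _ _ _ _ _ _ _) _ => [||||||||x y /cov /exists_ord_or|];
  last 2 first.
- by rewrite !big_ord_recl big_ord0 !inE !orbF.
all: by clear cov; lia.
Qed.

(** * The exceptional constructions *)

(** Color [i < 3] owns the edge opposite vertex [i], so a pair is covered by the color of the third
    vertex; further colors get empty blocks. *)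
Lemma rainbow_triangle_cover r (p : r.+3.-tuple nat) :
    (forall i : 'I_r.+3, (if i < 3 then 2 else 0) < tnth p i) ->
  @block_cover 'I_3 _ p (fun i => if i < 3 then [set~ inord i] else set0)
    (fun=> set0).
Proof.
move=> p_gt; split=> [i|x y xy].
  rewrite cards0 addn0; apply: leq_ltn_trans (p_gt i).
  by case: ifP; rewrite ?cards0 // cardsC1 card_ord.
have [z /andP[xz yz]] : exists z : 'I_3, (x != z) && (y != z).
  apply/existsP; case: x xy => [[|[|[|]]]] // ?; case: y => [[|[|[|]]]] // ? _;
  apply/existsP; by [exists ord0 | exists (inord 1); rewrite -!val_eqE /= inordK
    | exists (inord 2); rewrite -!val_eqE /= inordK].
exists (widen_ord (isT : 3 <= r.+3) z).
by rewrite !inE /= ltn_ord !inE inord_val xz yz.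
Qed.

(** Indices act both as vertices and as colors: [ord0] owns the triangle on the other three
    vertices, and any other [i] owns the edge from [ord0] to [i]. *)
Lemma triangle_star_cover : @block_cover 'I_4 _ [tuple 4; 3; 3; 3]
  (fun i => if i == ord0 then [set~ ord0] else [set ord0; i]) (fun=> set0).
Proof.
split=> [i|x y xy].
  rewrite cards0 addn0; case: i => [[|[|[|[|]]]]] //= i4;
  by rewrite ?cardsC1 ?card_ord // cards2.
have [x0|x0] := eqVneq x ord0; have [y0|y0] := eqVneq y ord0.
- by rewrite x0 y0 eqxx in xy.
- by exists y; rewrite (negPf y0) !inE x0 !eqxx !orbT.
- by exists x; rewrite (negPf x0) !inE y0 !eqxx !orbT.
- by exists ord0; rewrite !inE x0 y0 !orbT.
Qed.

(** * The values for two, three and four colors *)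

Theorem corollary3p8 :
  (forall p1 p2 : nat, p1 >= p2 -> p2 >= 2 ->
     is_RPM [tuple p1; p2] (p1 + ceil_div p2 3 - 1)) /\
  ((forall p1 p2 p3 : nat, p1 >= p2 -> p2 >= p3 -> p3 >= 2 ->
      (p1, p2, p3) <> (3, 3, 3) ->
      is_RPM [tuple p1; p2; p3] (p1 + ceil_div p2 3 + ceil_div p3 3 - 2)) /\
   is_RPM [tuple 3; 3; 3] 4) /\
  ((forall p1 p2 p3 p4 : nat, p1 >= p2 -> p2 >= p3 -> p3 >= p4 -> p4 >= 2 ->
      (p1, p2, p3, p4) \notin [:: (3, 3, 3, 3); (4, 3, 3, 3); (3, 3, 3, 2)] ->
      is_RPM [tuple p1; p2; p3; p4]
        (p1 + ceil_div p2 3 + ceil_div p3 3 + ceil_div p4 3 - 3)) /\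
   is_RPM [tuple 3; 3; 3; 3] 4 /\
   is_RPM [tuple 4; 3; 3; 3] 5 /\
   is_RPM [tuple 3; 3; 3; 2] 4).
Proof.
have rainbow_is_RPM r (p : r.+3.-tuple nat) :
    (forall i : 'I_r.+3, (if i < 3 then 2 else 0) < tnth p i) ->
    (forall A S, ~ @block_cover 'I_4 _ p A S) -> is_RPM p 4.
  move=> /rainbow_triangle_cover cov.
  by apply: block_cover_is_RPM cov _; rewrite card_ord.
split; [|split; [split|split; [|split; [|split]]]].
- move=> p1 p2 le21 p2_ge2.
  apply: is_RPM_of_part_size => [i||A S]; last exact: no_block_cover2.
    by case: i => [[|[|]]] //= ?; rewrite /tnth /=; lia.
  by rewrite !big_ord_recl big_ord0 /part_size /tnth /= /ceil_div; lia.
- move=> p1 p2 p3 le21 le32 p3_ge2 ne.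
  apply: is_RPM_of_part_size => [i||A S].
  + by case: i => [[|[|[|]]]] //= ?; rewrite /tnth /=; lia.
  + by rewrite !big_ord_recl big_ord0 /part_size /tnth /= /ceil_div; lia.
  apply: no_block_cover3 => //; rewrite -[leqRHS]addn0 leq_add2l leqn0 eqb0.
  apply: contra_notN ne; rewrite /exceptional.
  case/orP=> [/and3P[/eqP h1 /eqP h2 /eqP h3]|/and4P[]] //.
  by congr (_, _, _); lia.
- apply: rainbow_is_RPM => [[[|[|[|]]] ?]|A S] //.
  exact: no_block_cover3.
- move=> p1 p2 p3 p4 le21 le32 le43 p4_ge2 ne.
  apply: is_RPM_of_part_size => [i||A S].
  + by case: i => [[|[|[|[|]]]]] //= ?; rewrite /tnth /=; lia.
  + by rewrite !big_ord_recl big_ord0 /part_size /tnth /= /ceil_div; lia.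
  apply: no_block_cover4 => //; rewrite -[leqRHS]addn0 leq_add2l leqn0 eqb0.
  (* Since [p4] is 2 or 3 once [p3 = 3], the [exceptional] quadruples are exactly the three excluded
     ones; elsewhere the extra term vanishes. *)
  apply: contra ne; rewrite /exceptional !inE !xpair_eqE; lia.
- apply: rainbow_is_RPM => [[[|[|[|[|]]]] ?]|A S] //.
  exact: no_block_cover4.
- apply: block_cover_is_RPM triangle_star_cover _ _; first by rewrite card_ord.
  by move=> A S; apply: no_block_cover4.
- apply: rainbow_is_RPM => [[[|[|[|[|]]]] ?]|A S] //.
  exact: no_block_cover4.
Qed.
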